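(* Let $\{X_{i,j},\, i\ge1,\, j\ge1\}$ be a double array of nonnegative random variables satisfying Condition $(H_{2q})$ for some $q\ge1$, let $\{b_n, n\ge1\}$ be an increasing sequence of positive constants, and let $\{\lambda_{m,n,i,j},\,1\le i\le m,\,1\le j\le n,\,m\ge1,\,n\ge1\}$ be an array of positive constants. For $s\ge0$, $m\ge1$, $n\ge1$ (integers), set $$a_{m,n}=\sum_{i=1}^{m}\sum_{j=1}^{n}\lambda_{m,n,i,j},\qquad X_{s,m,n}=X_{m,n}\mathbf{1}\left(X_{m,n}\le b_{2^s}\right)+b_{2^s}\mathbf{1}\left(X_{m,n}>b_{2^s}\right).$$ Then there is a finite constant $C(q)$ depending only on $q$ such that for all $m\ge1$, $n\ge1$, $$\begin{aligned} &\mathbb{E}\left(\max_{\substack{1\le u<2^m\\ 1\le v<2^n}}\left|\sum_{i=1}^{u}\sum_{j=1}^{v}(X_{m+n,i,j}-\mathbb{E}X_{m+n,i,j})\right|^{2q}\right)\\ &\quad\le C(q)\left(\sum_{s=1}^{m}\sum_{t=1}^{n}2^{s+t}b_{2^{s+t}}\max_{\substack{1\le i<2^m\\ 1\le j<2^n}}\mathbb{P}\left(X_{i,j}>b_{2^{s+t-2}}\right)\right)^{2q}\\ &\qquad+C(q)\,a_{m,n}^{2q}\sum_{s=1}^{m}\sum_{t=1}^{n}2^{m+n}\lambda_{m,n,s,t}^{-2q}\left(\max_{\substack{1\le i<2^m\\ 1\le j<2^n}}\mathbb{E}X_{s+t,i,j}^{2q}+2^{(s+t)(q-1)}\max_{\substack{1\le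 i<2^m\\ 1\le j<2^n}}\left(\mathbb{E}X_{s+t,i,j}^{2}\right)^{q}\right). \end{aligned}$$
   Context: $\mathbf{1}(\cdot)$ is the indicator function. The random variables $X_{i,j}$ are not assumed integrable. Condition $(H_{2q})$: let $q\ge 1$ be a real number. A family of random variables $\{X_\lambda,\lambda\in\Lambda\}$ (on a common probability space) satisfies Condition $(H_{2q})$ if there is a finite constant $C(q)$ depending only on $q$ (in particular not on $I$ or on the functions $f_\lambda$) such that for every finite subset $I\subset\Lambda$ and every family of increasing functions $f_\lambda:\mathbb{R}\to\mathbb{R}$, $\lambda\in I$, $$\mathbb{E}\left|\sum_{\lambda\in I}\left(f_\lambda(X_\lambda)-\mathbb{E}f_\lambda(X_\lambda)\right)\right|^{2q}\le C(q)\left(|I|\max_{\lambda\in I}\mathbb{E}|f_\lambda(X_\lambda)|^{2q}+|I|^{q}\max_{\lambda\in I}\left(\mathbb{E}f_\lambda^2(X_\lambda)\right)^{q}\right),$$ provided the expectations are finite. Here $|I|$ is the cardinality of $I$. ''Increasing'' is understood in the sense of nondecreasing. The symbol $C(q)$ is a generic constant, not necessarily the same at each appearance; the constant in Condition $(H_{2q})$ counts as depending only on $q$, so the constant in the conclusion depends only on $q$ and on the constant in Condition $(H_{2q})$. *)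

(* Defs.v *)
From HB Require Import structures.
From mathcomp Require Import all_boot all_order all_algebra finmap.
From mathcomp Require Import all_classical all_reals all_analysis.

Set Implicit Arguments.
Unset Strict Implicit.
Unset Printing Implicit Defensive.
Import Order.TTheory GRing.Theory Num.Theory.
Import numFieldNormedType.Exports.

Local Open Scope classical_set_scope.
Local Open Scope ring_scope.

(* Condition (H_{2q}) with constant C, for the family of the X l with l in L.
   The constant is an argument so that statements can make explicit what their
   own constants depend on.  Maxima of nonnegative quantities are taken with
   base value 0. *)
Definition condition_H (R : realType) (d : measure_display)
    (T : measurableType d) (P : probability T R) (q C : R)
    (Lam : choiceType) (L : set Lam) (X : Lam -> {RV P >-> R}) : Prop :=
  forall (I : {fset Lam}) (f : Lam -> R -> R),
    (forall l, l \in I -> L l) ->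
    (forall l, l \in I -> {homo f l : x y / x <= y}) ->
    (forall l, l \in I ->
      [/\ ('E_P[fun w => `|f l (X l w)|%R] < +oo)%E,
          ('E_P[fun w => (f l (X l w) ^+ 2)%R] < +oo)%E
        & ('E_P[fun w => (`|f l (X l w)| `^ (2 * q))%R] < +oo)%E]) ->
    ('E_P[fun w => (`|\sum_(l <- I)
            (f l (X l w) - fine 'E_P[fun w' => f l (X l w')])| `^ (2 * q))%R]
     <= C%:E *
        ((#|` I|%:R)%:E *
           \big[maxe/0]_(l <- I) 'E_P[fun w => (`|f l (X l w)| `^ (2 * q))%R]
         + (#|` I|%:R `^ q)%:E *
           \big[maxe/0]_(l <- I)
             (('E_P[fun w => (f l (X l w) ^+ 2)%R]) `^ q)))%E.

Section Truncation.
Context {R : realType} {d : measure_display} {T : measurableType d}.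
Variables (b : nat -> R) (X : nat -> nat -> T -> R).

Definition trunc (s i j : nat) (w : T) : R :=
  X i j w * (X i j w <= b (2 ^ s)%N)%R%:R
  + b (2 ^ s)%N * (b (2 ^ s)%N < X i j w)%R%:R.

End Truncation.

Definition lambda_sum (R : realType) (lam : nat -> nat -> nat -> nat -> R)
    (m n : nat) : R :=
  \sum_(1 <= i < m.+1) \sum_(1 <= j < n.+1) lam m n i j.

(* The maximum of F over the indices 1 <= i < 2^m, 1 <= j < 2^n; it is only
   applied to F with nonnegative values, to m >= 1 and to n >= 1. *)
Definition emax_dyadic (R : realType) (m n : nat) (F : nat -> nat -> \bar R)
    : \bar R :=
  (\big[maxe/0]_(1 <= i < 2 ^ m) \big[maxe/0]_(1 <= j < 2 ^ n) F i j)%E.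

Definition max_dyadic (R : realType) (m n : nat) (F : nat -> nat -> R) : R :=
  \big[Num.max/0]_(1 <= i < 2 ^ m) \big[Num.max/0]_(1 <= j < 2 ^ n) F i j.

(* Main.v *)
Require Import Defs.
From HB Require Import structures.
From mathcomp Require Import all_boot all_order all_algebra finmap.
From mathcomp Require Import all_classical all_reals all_analysis.
From mathcomp Require Import measurable_realfun ring lra.
Import Order.TTheory GRing.Theory Num.Theory.
Import numFieldNormedType.Exports.
Local Open Scope classical_set_scope.
Local Open Scope ring_scope.

Set Implicit Arguments.
Unset Strict Implicit.
Unset Printing Implicit Defensive.

(** Write [Y_k] for [X] clipped at [b (2 ^ k)].  The maximal inequality is a
two-dimensional dyadic chaining in which the truncation level follows the scale
of the block.

Rounding [u] down to multiples of [2 ^ s] cuts [(0, u]] into cells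
[(dyadic_floor s u, dyadic_floor s.-1 u]], each empty or of length [2 ^ s.-1];
doing the same for [v] cuts the rectangle [(0, u] x (0, v]] into cells indexed by
[(s, t)].  On the cell [(s, t)] the variable [Y_(m+n)] is replaced by
[Y_(s+t-2)].  The error [Y_(m+n) - Y_(s+t-2)] is paid by the increments
[W_(i,j) = Y_(i+j) - Y_(i+j-2)] with [i >= s] and [j >= t]
([sum_staircase_ge]: the increments along one row and one column already
telescope to it).  Collecting, for each [(i, j)], the cells that use [W_(i,j)]
gives a rectangle contained in one dyadic block of size [2 ^ i x 2 ^ j].  As [W]
is nonnegative, its sum over this rectangle is at most its sum over the whole
block; this leaves block sums which no longer depend on [u] and [v] except
through the index of the block ([dyadic_chaining]).

Every cell or block sum is then a centered sum plus, for the increments, twice an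
expectation.  The expectations are at most [b (2 ^ (s+t)) P(X > b (2 ^ (s+t-2)))]
per entry and produce the first term of the bound.  Both [Y_k] and [W] are
nondecreasing functions of [X], so the moment hypothesis controls each centered
sum; the maximum over the dyadic blocks of a given scale is bounded by the sum
over these blocks ([sum_centered_sum_moment]).  There are [2 ^ (m+n-s-t)] blocks
of [2 ^ (s+t)] entries, whence the factor [2 ^ (m+n)].  Finally the sum over the
scales is taken out of the power [2 q] at the price of the weights [lam]
([powR_sum_weighted]). *)

(** * Dyadic chaining in two dimensions *)

Definition dyadic_floor (s u : nat) : nat := (u %/ 2 ^ s * 2 ^ s)%N.

Lemma dyadic_floor0 u : dyadic_floor 0 u = u.
Proof. by rewrite /dyadic_floor expn0 divn1 muln1. Qed.

Lemma dyadic_floor_small m u : (u < 2 ^ m)%N -> dyadic_floor m u = 0%N.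
Proof. by move=> um; rewrite /dyadic_floor divn_small. Qed.

Lemma dyadic_floorS s u : (dyadic_floor s.+1 u <= dyadic_floor s u)%N.
Proof.
rewrite /dyadic_floor expnSr divnMA (mulnC (2 ^ s)%N) mulnA leq_mul2r.
by rewrite leq_divM orbT.
Qed.

Lemma dyadic_floor_le s u : (dyadic_floor s u <= u)%N.
Proof. exact: leq_divM. Qed.

Lemma ltn_dyadic_ceil s u : (u < dyadic_floor s u + 2 ^ s)%N.
Proof. by rewrite {1}(divn_eq u (2 ^ s)) ltn_add2l ltn_pmod // expn_gt0. Qed.

Lemma sum_dyadic_cells (V : nmodType) (F : nat -> V) (u m : nat) :
  \sum_((dyadic_floor m u).+1 <= i < u.+1) F i =
  \sum_(1 <= s < m.+1)
    \sum_((dyadic_floor s u).+1 <= i < (dyadic_floor s.-1 u).+1) F i.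
Proof.
elim: m => [|m IH]; first by rewrite dyadic_floor0 !big_geq.
rewrite [RHS]big_nat_recr //= -IH addrC -big_cat_nat //=.
- by rewrite ltnS dyadic_floorS.
- by rewrite ltnS dyadic_floor_le.
Qed.

(** Each cell [s] contributes the terms of all coarser scales [k >= s]; for a
fixed [k] the cells [s <= k] that use it fill the interval from the rounding of
[u] at scale [k] up to [u]. *)
Lemma exchange_sum_dyadic_cells (V : nmodType) (F : nat -> nat -> V)
    (u m : nat) :
  \sum_(1 <= s < m.+1)
    \sum_((dyadic_floor s u).+1 <= i < (dyadic_floor s.-1 u).+1)
      \sum_(s <= k < m.+1) F k i =
  \sum_(1 <= k < m.+1) \sum_((dyadic_floor k u).+1 <= i < u.+1) F k i.
Proof.
elim: m => [|m IH]; first by rewrite !big_geq.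
rewrite [RHS]big_nat_recr //= -IH sum_dyadic_cells.
rewrite [X in _ = _ + X]big_nat_recr //= addrA -big_split /=.
rewrite [LHS]big_nat_recr //=; congr (_ + _).
  apply: eq_big_nat => s /andP[s1 sm]; rewrite -big_split /=.
  by apply: eq_bigr => i _; rewrite big_nat_recr //= ltnW.
by apply: eq_bigr => i _; rewrite big_nat1.
Qed.

Lemma ler_sum_nat_sub {R : numDomainType} (F : nat -> R) (a b c : nat) :
  (b <= c)%N -> (forall i, (a <= i < c)%N -> 0 <= F i) ->
  \sum_(a <= i < b) F i <= \sum_(a <= i < c) F i.
Proof.
move=> bc F0; have [ab|ba] := leqP a b; last first.
  by rewrite big_geq ?(ltnW ba) // big_nat_cond sumr_ge0 // => i /andP[/F0].
rewrite [leRHS](big_cat_nat ab bc) /= lerDl big_nat_cond sumr_ge0 // => i.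
by move=> /andP[/andP[bi ic] _]; rewrite F0 // ic (leq_trans ab bi).
Qed.

(** The two-step difference [x (i + j) - x (i + j - 2)] splits into two one-step
differences.  The first kind along the row [i = m] telescopes from [m + t - 1] to
[m + n], the second kind along the column [j = t] from [s + t - 2] to
[m + t - 1]; all the other terms are nonnegative. *)
Lemma sum_staircase_ge {R : realDomainType} (x : nat -> R) (s t m n : nat) :
  (forall k l, (k <= l)%N -> x k <= x l) ->
  (1 <= s <= m)%N -> (1 <= t <= n)%N ->
  x (m + n)%N - x (s + t - 2)%N <=
  \sum_(s <= i < m.+1) \sum_(t <= j < n.+1) (x (i + j)%N - x (i + j - 2)%N).
Proof.
move=> xh /andP[s1 sm] /andP[t1 tn].
pose p i j := x (i + j)%N - x (i + j).-1; pose r i j := x (i + j).-1 - x (i + j - 2)%N.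
have p0 i j : 0 <= p i j by rewrite subr_ge0 xh // leq_pred.
have r0 i j : 0 <= r i j by rewrite subr_ge0 xh // -subn1 leq_sub2l.
(* the row [i = m] of [p] and the column [j = t] of [r] *)
have -> : x (m + n)%N - x (s + t - 2)%N =
    \sum_(t <= j < n.+1) p m j + \sum_(s <= i < m.+1) r i t.
  pose f j := x (m + j).-1; pose g i := x (i + t - 2)%N.
  rewrite (eq_bigr (fun j => f j.+1 - f j)); last first.
    by move=> j _; rewrite /p /f addnS.
  rewrite telescope_sumr ?(leq_trans tn) //.
  rewrite [X in _ = _ + X](eq_bigr (fun i => g i.+1 - g i)); last first.
    by move=> i _; rewrite /r /g addSn subSS subn1.
  rewrite telescope_sumr ?(leq_trans sm) // /f /g.
  by rewrite addnS addSn subSS subn1 addrA subrK.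
have -> : \sum_(s <= i < m.+1) \sum_(t <= j < n.+1) (x (i + j)%N - x (i + j - 2)%N)
   = \sum_(s <= i < m.+1) \sum_(t <= j < n.+1) p i j
     + \sum_(s <= i < m.+1) \sum_(t <= j < n.+1) r i j.
  rewrite -big_split /=; apply: eq_bigr => i _; rewrite -big_split /=.
  by apply: eq_bigr => j _; rewrite /p /r addrA subrK.
apply: lerD.
  rewrite [leRHS]big_nat_recr //= lerDr; apply: sumr_ge0 => i _.
  exact: sumr_ge0.
apply: ler_sum => i _; rewrite [leRHS]big_ltn //= lerDl.
exact: sumr_ge0.
Qed.

(** The deterministic core.  In the application [z] is a clipped variable minus
its mean and [y] the same variable plus its mean: the increments of [z] from one
level to another are dominated by those of [y], which are nonnegative and may
thus be summed over a larger set. *)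
Lemma dyadic_chaining {R : realDomainType} (z y : nat -> nat -> nat -> R)
    (m n u v : nat) :
  (u < 2 ^ m)%N -> (v < 2 ^ n)%N ->
  (forall i j k l, (1 <= i)%N -> (1 <= j)%N -> (k <= l)%N ->
     `|z l i j - z k i j| <= y l i j - y k i j) ->
  `|\sum_(1 <= i < u.+1) \sum_(1 <= j < v.+1) z (m + n)%N i j| <=
  \sum_(1 <= s < m.+1) \sum_(1 <= t < n.+1)
    `|\sum_((dyadic_floor s u).+1 <= i < (dyadic_floor s.-1 u).+1)
        \sum_((dyadic_floor t v).+1 <= j < (dyadic_floor t.-1 v).+1)
          z (s + t - 2)%N i j|
  + \sum_(1 <= s < m.+1) \sum_(1 <= t < n.+1)
    \sum_((dyadic_floor s u).+1 <= i < dyadic_floor s u + 2 ^ s)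
      \sum_((dyadic_floor t v).+1 <= j < dyadic_floor t v + 2 ^ t)
        (y (s + t)%N i j - y (s + t - 2)%N i j).
Proof.
move=> um vn zy.
have yh i j : (1 <= i)%N -> (1 <= j)%N ->
    forall k l, (k <= l)%N -> y k i j <= y l i j.
  by move=> i1 j1 k l kl; rewrite -subr_ge0 (le_trans _ (zy i j k l i1 j1 kl)).
pose cu s := index_iota (dyadic_floor s u).+1 (dyadic_floor s.-1 u).+1.
pose cv t := index_iota (dyadic_floor t v).+1 (dyadic_floor t.-1 v).+1.
have cells (F : nat -> nat -> nat -> nat -> R) :
   \sum_(1 <= s < m.+1) \sum_(i <- cu s) \sum_(1 <= t < n.+1) \sum_(j <- cv t)
      F s t i j =
   \sum_(1 <= s < m.+1) \sum_(1 <= t < n.+1) \sum_(i <- cu s) \sum_(j <- cv t)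
      F s t i j.
  by apply: eq_bigr => s _; exact: exchange_big.
have -> : \sum_(1 <= i < u.+1) \sum_(1 <= j < v.+1) z (m + n)%N i j =
    \sum_(1 <= s < m.+1) \sum_(1 <= t < n.+1) \sum_(i <- cu s) \sum_(j <- cv t)
      z (m + n)%N i j.
  rewrite -cells -{1}(dyadic_floor_small um) sum_dyadic_cells.
  apply: eq_bigr => s _; apply: eq_bigr => i _.
  by rewrite -{1}(dyadic_floor_small vn) sum_dyadic_cells.
have -> : \sum_(1 <= s < m.+1) \sum_(1 <= t < n.+1)
      \sum_(i <- cu s) \sum_(j <- cv t) z (m + n)%N i j =
    \sum_(1 <= s < m.+1) \sum_(1 <= t < n.+1)
      \sum_(i <- cu s) \sum_(j <- cv t) z (s + t - 2)%N i j +
    \sum_(1 <= s < m.+1) \sum_(1 <= t < n.+1)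
      \sum_(i <- cu s) \sum_(j <- cv t) (z (m + n)%N i j - z (s + t - 2)%N i j).
  do 4 (rewrite -big_split /=; apply: eq_bigr => ? _).
  by rewrite addrC subrK.
apply: (le_trans (ler_normD _ _)); apply: lerD.
  apply: (le_trans (ler_norm_sum _ _ _)); apply: ler_sum => s _.
  exact: ler_norm_sum.
(* replacing the level [m + n] by [s + t - 2] on the cell [(s, t)] costs increments *)
pose w s t i j := y (s + t)%N i j - y (s + t - 2)%N i j.
apply: (@le_trans _ _ (\sum_(1 <= s < m.+1) \sum_(1 <= t < n.+1)
    \sum_(i <- cu s) \sum_(j <- cv t)
    \sum_(s <= k < m.+1) \sum_(t <= l < n.+1) w k l i j)).
  apply: (le_trans (ler_norm_sum _ _ _)); apply: ler_sum_nat => s /andP[s1 sm].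
  apply: (le_trans (ler_norm_sum _ _ _)); apply: ler_sum_nat => t /andP[t1 tn].
  apply: (le_trans (ler_norm_sum _ _ _)); apply: ler_sum_nat => i /andP[i1 _].
  apply: (le_trans (ler_norm_sum _ _ _)); apply: ler_sum_nat => j /andP[j1 _].
  have {}i1 : (1 <= i)%N by exact: leq_trans i1.
  have {}j1 : (1 <= j)%N by exact: leq_trans j1.
  apply: le_trans (zy i j _ _ i1 j1 _) _.
    by rewrite (leq_trans (leq_subr _ _)) // leq_add.
  apply: (@sum_staircase_ge _ (fun k => y k i j)); first exact: yh.
    by rewrite s1.
  by rewrite t1.
have -> : \sum_(1 <= s < m.+1) \sum_(1 <= t < n.+1)
    \sum_(i <- cu s) \sum_(j <- cv t)
    \sum_(s <= k < m.+1) \sum_(t <= l < n.+1) w k l i j =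
  \sum_(1 <= s < m.+1) \sum_(1 <= t < n.+1)
  \sum_((dyadic_floor s u).+1 <= i < u.+1) \sum_((dyadic_floor t v).+1 <= j < v.+1)
    w s t i j.
  rewrite -cells.
  pose G k i := \sum_(1 <= l < n.+1) \sum_((dyadic_floor l v).+1 <= j < v.+1) w k l i j.
  transitivity (\sum_(1 <= s < m.+1) \sum_(i <- cu s) \sum_(s <= k < m.+1) G k i).
    apply: eq_bigr => s _; apply: eq_bigr => i _.
    rewrite /G; under [RHS]eq_bigr do rewrite -exchange_sum_dyadic_cells.
    rewrite [RHS]exchange_big /=; apply: eq_bigr => t _.
    by rewrite exchange_big.
  rewrite exchange_sum_dyadic_cells /G; apply: eq_bigr => s _.
  exact: exchange_big.
apply: ler_sum_nat => s _; apply: ler_sum_nat => t _.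
(* the part of the block before [u] and [v] is completed to the full block *)
have w0 i j : (0 < i)%N -> (0 < j)%N -> 0 <= w s t i j.
  by move=> i1 j1; rewrite subr_ge0 yh // leq_subr.
apply: (@le_trans _ _ (\sum_((dyadic_floor s u).+1 <= i < u.+1)
    \sum_((dyadic_floor t v).+1 <= j < dyadic_floor t v + 2 ^ t) w s t i j)).
  apply: ler_sum_nat => i /andP[i1 _]; apply: ler_sum_nat_sub.
    exact: ltn_dyadic_ceil.
  by move=> j /andP[j1 _]; rewrite w0 ?(leq_trans _ i1) ?(leq_trans _ j1).
apply: ler_sum_nat_sub; first exact: ltn_dyadic_ceil.
move=> i /andP[i1 _]; rewrite big_nat_cond sumr_ge0 // => j /andP[/andP[j1 _] _].
by rewrite w0 ?(leq_trans _ i1) ?(leq_trans _ j1).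
Qed.

(** * Powers, maxima and expectations *)

(** A weighted convexity bound: if [M] is the maximum of the [x j / lam j], the
sum of the [x j] is at most [M] times the sum of the [lam j], and [M `^ p] is at
most the sum of the [(x j / lam j) `^ p]. *)
Lemma powR_sum_weighted {R : realType} (J : eqType) (r : seq J) (p : R)
    (x lam : J -> R) :
  0 < p -> {in r, forall j, 0 <= x j} -> {in r, forall j, 0 < lam j} ->
  (\sum_(j <- r) x j) `^ p <=
  (\sum_(j <- r) lam j) `^ p * \sum_(j <- r) lam j `^ (- p) * x j `^ p.
Proof.
move=> p0 x0 lam0; set S := (X in _ <= _ * X).
have S0 : 0 <= S by apply: sumr_ge0 => j _; rewrite mulr_ge0 ?powR_ge0.
have xle j : j \in r -> x j <= lam j * S `^ p^-1.
  move=> jr; rewrite -ler_pdivrMl ?lam0 //.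
  have y0 : 0 <= (lam j)^-1 * x j by rewrite mulr_ge0 ?x0 ?invr_ge0 ?ltW ?lam0.
  rewrite -[leLHS](powRr1 y0) -(mulfV (lt0r_neq0 p0)) powRrM.
  apply: ge0_ler_powR; rewrite ?nnegrE ?powR_ge0 ?invr_ge0 ?(ltW p0) //.
  rewrite powRM ?x0 ?invr_ge0 ?(ltW (lam0 _ jr)) //.
  rewrite -powR_inv1 ?(ltW (lam0 _ jr)) // -powRrM mulN1r.
  rewrite /S (big_rem j) //= lerDl; apply: sumr_ge0 => i _.
  by rewrite mulr_ge0 ?powR_ge0.
have lam_sum0 : 0 <= \sum_(j <- r) lam j.
  by rewrite big_seq sumr_ge0 // => j jr; rewrite ltW ?lam0.
have -> : S = (S `^ p^-1) `^ p.
  by rewrite -powRrM mulVf ?lt0r_neq0 // powRr1.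
rewrite -powRM ?powR_ge0 // ge0_ler_powR ?nnegrE ?(ltW p0) //.
- by rewrite big_seq sumr_ge0.
- by rewrite mulr_ge0 ?powR_ge0.
by rewrite mulr_suml big_seq [leRHS]big_seq ler_sum.
Qed.

Lemma powR_add3_le {R : realType} (p x y z : R) :
  0 < p -> 0 <= x -> 0 <= y -> 0 <= z ->
  (x + y + z) `^ p <= 3 `^ p * (x `^ p + y `^ p + z `^ p).
Proof.
move=> p0 x0 y0 z0.
have xyz : {in [:: x; y; z], forall j, 0 <= j}.
  by move=> j; rewrite !inE => /or3P[] /eqP ->.
have := @powR_sum_weighted R R [:: x; y; z] p id (fun=> 1) p0 xyz (fun _ _ => ltr01).
by rewrite !big_cons !big_nil !powR1 !mul1r !addr0 !addrA -!mulr2n -mulrSr.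
Qed.

Lemma max_dyadic_powR_le {R : realType} (m n : nat) (F : nat -> nat -> R) (p c : R) :
  0 < p -> 0 <= c ->
  (forall u v, (1 <= u < 2 ^ m)%N -> (1 <= v < 2 ^ n)%N ->
    0 <= F u v /\ F u v `^ p <= c) ->
  max_dyadic m n F `^ p <= c.
Proof.
move=> p0 c0 Fc.
have -> : c = (c `^ p^-1) `^ p by rewrite -powRrM mulVf ?lt0r_neq0 // powRr1.
have max0 : 0 <= max_dyadic m n F by exact: bigmax_ge_id.
apply: ge0_ler_powR; rewrite ?nnegrE ?(ltW p0) ?powR_ge0 //.
rewrite /max_dyadic big_seq; apply: bigmax_le => [|u]; first exact: powR_ge0.
rewrite mem_index_iota => hu; rewrite big_seq.
apply: bigmax_le => [|v]; first exact: powR_ge0.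
rewrite mem_index_iota => hv; have [F0 Fle] := Fc u v hu hv.
rewrite -[F u v](powRr1 F0) -(mulfV (lt0r_neq0 p0)) powRrM.
by apply: ge0_ler_powR; rewrite ?nnegrE ?powR_ge0 ?invr_ge0 ?(ltW p0).
Qed.

Lemma le_emax_dyadic {R : realType} (m n : nat) (F : nat -> nat -> \bar R) (i j : nat) :
  (1 <= i < 2 ^ m)%N -> (1 <= j < 2 ^ n)%N -> (F i j <= emax_dyadic m n F)%E.
Proof.
move=> hi hj; apply: (@bigmax_sup_seq _ _ _ _ _ i); rewrite ?mem_index_iota //.
by apply: (@le_bigmax_seq _ _ _ _ _ j); rewrite ?mem_index_iota.
Qed.

(** A maximum of bounded nonnegative quantities is a real number; this moves the
estimates from the extended reals to the reals. *)
Lemma emax_dyadic_fineK {R : realType} (m n : nat) (F : nat -> nat -> \bar R) (c : R) :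
  0 <= c ->
  (forall i j, (1 <= i)%N -> (1 <= j)%N -> (F i j <= c%:E)%E) ->
  ((fine (emax_dyadic m n F))%:E = emax_dyadic m n F)%E /\
  0 <= fine (emax_dyadic m n F).
Proof.
move=> c0 Fc.
have e0 : (0 <= emax_dyadic m n F)%E by exact: bigmax_ge_id.
split; last exact: fine_ge0.
rewrite fineK // ge0_fin_numE // (@le_lt_trans _ _ c%:E) ?ltry //.
rewrite /emax_dyadic big_seq; apply: bigmax_le => [|i]; first by rewrite lee_fin.
rewrite mem_index_iota => /andP[i1 _]; rewrite big_seq.
apply: bigmax_le => [|j]; first by rewrite lee_fin.
by rewrite mem_index_iota => /andP[j1 _]; exact: Fc.
Qed.

Section Expectation.
Context {R : realType} {d : measure_display} {T : measurableType d}.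
Context (P : probability T R).
Implicit Types f g : T -> R.

Lemma Lfun1_bounded f c :
  measurable_fun setT f -> (forall w, `|f w| <= c) -> f \in Lfun P 1.
Proof.
move=> mf fc; apply/Lfun1_integrable.
apply: measurable_bounded_integrable => //.
  by rewrite (le_lt_trans (probability_le1 P _)) ?ltry.
exists c; split; first exact: num_real.
by move=> x cx w _ /=; rewrite (le_trans (fc w)) // ltW.
Qed.

Lemma expectation_bounded f c :
  measurable_fun setT f -> (forall w, 0 <= f w <= c) ->
  ('E_P[f] <= c%:E)%E /\ ('E_P[f] \is a fin_num)%E.
Proof.
move=> mf fc.
have Ef : ('E_P[f] <= c%:E)%E.
  rewrite -(expectation_cst P) expectation_le //.
  - by move=> w; case/andP: (fc w).
  - by move=> w; case/andP: (fc w) => /le_trans; apply.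
  - by apply: aeW => w; case/andP: (fc w).
split=> //; rewrite ge0_fin_numE ?(le_lt_trans Ef) ?ltry //.
by apply: expectation_ge0 => w; case/andP: (fc w).
Qed.

Lemma ge0_expectationD f g :
  measurable_fun setT f -> measurable_fun setT g ->
  (forall w, 0 <= f w) -> (forall w, 0 <= g w) ->
  ('E_P[fun w => (f w + g w)%R] = 'E_P[f] + 'E_P[g])%E.
Proof.
move=> mf mg f0 g0; rewrite unlock.
under eq_integral do rewrite EFinD.
rewrite ge0_integralD //.
- by move=> w _; rewrite lee_fin.
- exact/measurable_EFinP.
- by move=> w _; rewrite lee_fin.
- exact/measurable_EFinP.
Qed.

Lemma ge0_expectationZ f c :
  measurable_fun setT f -> (forall w, 0 <= f w) -> 0 <= c ->
  ('E_P[fun w => (c * f w)%R] = c%:E * 'E_P[f])%E.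
Proof.
move=> mf f0 c0; rewrite unlock.
under eq_integral do rewrite EFinM.
rewrite ge0_integralZl //; first exact/measurable_EFinP.
by move=> w _; rewrite lee_fin.
Qed.

Lemma ge0_expectation_sum (J : Type) (r : seq J) (F : J -> T -> R) :
  (forall j, measurable_fun setT (F j)) -> (forall j w, 0 <= F j w) ->
  ('E_P[fun w => (\sum_(j <- r) F j w)%R] = \sum_(j <- r) 'E_P[F j])%E.
Proof.
move=> mF F0; rewrite unlock.
under eq_integral do rewrite -sumEFin.
rewrite ge0_integral_sum //; first by move=> j; exact/measurable_EFinP.
by move=> j w _; rewrite lee_fin.
Qed.

Lemma measurable_norm_powR f p :
  measurable_fun setT f -> measurable_fun setT (fun w => `|f w| `^ p).
Proof.
move=> mf; apply: (measurableT_comp (@measurable_powR R p)).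
exact: measurableT_comp.
Qed.

Lemma measurable_max_dyadic (m n : nat) (F : nat -> nat -> T -> R) :
  (forall u v, measurable_fun setT (F u v)) ->
  measurable_fun setT (fun w => max_dyadic m n (fun u v => F u v w)).
Proof.
move=> mF.
have mbig (r : seq nat) (G : nat -> T -> R) :
    (forall u, measurable_fun setT (G u)) ->
    measurable_fun setT (fun w => \big[Num.max/0]_(u <- r) G u w).
  move=> mG; elim: r => [|u r IH].
    by under eq_fun do rewrite big_nil; exact: measurable_cst.
  by under eq_fun do rewrite big_cons; exact: measurable_maxr.
by apply: (mbig _ (fun u w => _)) => u; exact: (mbig _ (fun v w => _)).
Qed.

End Expectation.

(** * Moments of centered sums over rectangles *)

Section Moments.
Context {R : realType} {d : measure_display} {T : measurableType d}.
Context (P : probability T R) (q C0 : R) (X : nat -> nat -> {RV P >-> R}).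
Hypothesis q1 : 1 <= q.
Hypothesis X0 : forall i j, (1 <= i)%N -> (1 <= j)%N -> forall w, 0 <= X i j w.
Hypothesis HX : condition_H q C0 [set p : nat * nat | (1 <= p.1)%N /\ (1 <= p.2)%N]
  (fun p => X p.1 p.2).

Definition centered_sum (g : R -> R) (a1 a2 b1 b2 : nat) (w : T) : R :=
  \sum_(a1 <= i < a2) \sum_(b1 <= j < b2)
    (g (X i j w) - fine 'E_P[fun w' => g (X i j w')]).

(** The functions to which the moment hypothesis is applied.  Bounds are required
on the nonnegative half-line only, where the variables take their values; they
make all the moments finite. *)
Definition bounded_monotone (g : R -> R) (c : R) : Prop :=
  [/\ measurable_fun setT g, {homo g : x y / x <= y}
    & forall x, 0 <= x -> 0 <= g x <= c].

Lemma measurable_comp_RV (g : R -> R) i j :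
  measurable_fun setT g -> measurable_fun setT (fun w => g (X i j w)).
Proof. by move=> mg; exact: (measurableT_comp mg (measurable_funPT (X i j))). Qed.

Lemma measurable_gt_RV c i j : measurable [set w | c < X i j w].
Proof.
rewrite -[X in measurable X]setTI.
exact: (measurable_fun_ltr (measurable_cst c) (measurable_funPT (X i j))).
Qed.

Lemma measurable_centered_sum (g : R -> R) a1 a2 b1 b2 :
  measurable_fun setT g -> measurable_fun setT (centered_sum g a1 a2 b1 b2).
Proof.
move=> mg; apply: measurable_sum => i; apply: measurable_sum => j.
by apply: measurable_funB => //; exact: measurable_comp_RV.
Qed.

(** The moment hypothesis on a rectangle with at most [N] entries.  Its constant
may be negative, hence the [Num.max C0 0], which permits to bound the
cardinality and the moments from above. *)
Lemma centered_sum_moment g c (a1 a2 b1 b2 N : nat) (A B : R) :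
  bounded_monotone g c ->
  (1 <= a1)%N -> (1 <= b1)%N -> ((a2 - a1) * (b2 - b1) <= N)%N ->
  0 <= A -> 0 <= B ->
  (forall i j, (a1 <= i < a2)%N -> (b1 <= j < b2)%N ->
    ('E_P[fun w => (g (X i j w) `^ (2 * q))%R] <= A%:E)%E /\
    (('E_P[fun w => (g (X i j w) ^+ 2)%R]) `^ q <= B%:E)%E) ->
  ('E_P[fun w => (`|centered_sum g a1 a2 b1 b2 w| `^ (2 * q))%R] <=
   (Num.max C0 0 * (N%:R * A + N%:R `^ q * B))%:E)%E.
Proof.
move=> [mg hg g0] a1_gt0 b1_gt0 leN A0 B0 AB.
have q0 : 0 <= q by rewrite (le_trans _ q1).
pose s := [seq (i, j) | i <- index_iota a1 a2, j <- index_iota b1 b2].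
have us : uniq s.
  apply: allpairs_uniq; rewrite ?iota_uniq //.
  by move=> [? ?] [? ?] _ _ [-> ->].
pose I := seq_fset tt s.
have Is l : l \in I -> (a1 <= l.1 < a2)%N /\ (b1 <= l.2 < b2)%N.
  rewrite seq_fsetE => /allpairsP[[i j] /= [hi hj ->]] /=.
  by move: hi hj; rewrite !mem_index_iota.
have Ipos l : l \in I -> (1 <= l.1)%N /\ (1 <= l.2)%N.
  move=> /Is[/andP[+ _] /andP[+ _]].
  by split; [exact: leq_trans a1_gt0 _ | exact: leq_trans b1_gt0 _].
have cardI : (#|` I| <= N)%N.
  by rewrite size_seq_fset undup_id // size_allpairs !size_iota.
have sumI (F : nat * nat -> R) : \sum_(l <- I) F l =
    \sum_(a1 <= i < a2) \sum_(b1 <= j < b2) F (i, j).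
  rewrite (perm_big _ (seq_fset_perm tt s)) undup_id // /s.
  by rewrite big_allpairs.
have c0 : 0 <= c by case/andP: (g0 0 (lexx 0)) => /le_trans; apply.
have gX0 l w : l \in I -> 0 <= g (X l.1 l.2 w) <= c.
  by move=> /Ipos[i1 j1]; exact/g0/X0.
have normE l : l \in I -> (fun w => (`|g (X l.1 l.2 w)| `^ (2 * q))%R) =
    (fun w => g (X l.1 l.2 w) `^ (2 * q)).
  by move=> lI; apply/funext => w; rewrite ger0_norm //; case/andP: (gX0 l w lI).
have finE (h : T -> R) e : measurable_fun setT h -> (forall w, 0 <= h w <= e) ->
    ('E_P[h] < +oo)%E.
  by move=> mh he; have [_ /fin_numPlt/andP[_]] := expectation_bounded P mh he.
have := HX (I := I) (f := fun _ => g).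
move=> /(_ (fun l lI => Ipos l lI) (fun _ _ => hg)).
have Hfin : forall l, l \in I ->
  [/\ ('E_P[fun w => `|g (X l.1 l.2 w)|%R] < +oo)%E,
      ('E_P[fun w => (g (X l.1 l.2 w) ^+ 2)%R] < +oo)%E
    & ('E_P[fun w => (`|g (X l.1 l.2 w)| `^ (2 * q))%R] < +oo)%E].
  move=> l lI; have mgX := measurable_comp_RV l.1 l.2 mg; split.
  - apply: (finE _ c) => [|w]; first exact: measurableT_comp.
    by case/andP: (gX0 l w lI) => *; rewrite normr_ge0 ger0_norm.
  - apply: (finE _ (c ^+ 2)) => [|w]; first exact: measurable_funX.
    by case/andP: (gX0 l w lI) => *; rewrite sqr_ge0 ler_sqr ?nnegrE.
  - apply: (finE _ (c `^ (2 * q))) => [|w]; first exact: measurable_norm_powR.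
    case/andP: (gX0 l w lI) => *; rewrite powR_ge0 ger0_norm //.
    by rewrite ge0_ler_powR ?nnegrE ?mulr_ge0.
move=> /(_ Hfin).
under [X in ('E_P[X] <= _)%E]eq_fun do rewrite sumI /=.
move=> /le_trans; apply.
set bA := \big[maxe/0%E]_(l <- I) _; set bB := \big[maxe/0%E]_(l <- I) _.
have bA0 : (0 <= bA)%E by exact: bigmax_ge_id.
have bB0 : (0 <= bB)%E by exact: bigmax_ge_id.
have bAA : (bA <= A%:E)%E.
  rewrite /bA big_seq; apply: bigmax_le => [|l lI]; first by rewrite lee_fin.
  by rewrite normE //; case: (Is l lI) => i1 j1; case: (AB _ _ i1 j1).
have bBB : (bB <= B%:E)%E.
  rewrite /bB big_seq; apply: bigmax_le => [|l lI]; first by rewrite lee_fin.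
  by case: (Is l lI) => i1 j1; case: (AB _ _ i1 j1).
have cardR : #|` I|%:R <= N%:R :> R by rewrite ler_nat.
have cardq : #|` I|%:R `^ q <= N%:R `^ q :> R by rewrite ge0_ler_powR ?nnegrE.
set inner := (X in (_ * X <= _)%E).
have inner0 : (0 <= inner)%E.
  by rewrite adde_ge0 // mule_ge0 ?lee_fin ?powR_ge0.
apply: (@le_trans _ _ ((Num.max C0 0)%:E * inner)%E).
  by rewrite lee_wpmul2r // lee_fin le_max lexx.
rewrite EFinM lee_wpmul2l ?lee_fin ?le_max ?lexx ?orbT //.
by rewrite EFinD !EFinM leeD // lee_pmul ?lee_fin ?powR_ge0.
Qed.

(** [K * L] rectangles of at most [N1 * N2] entries each: since
[K * N1 * (L * N2) = 2 ^ k], the linear term [N * A] sums to [2 ^ k * A], and the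
term [N `^ q * B] to [2 ^ k * N `^ (q - 1) * B], where [N <= 2 ^ r]. *)
Lemma sum_centered_sum_moment g c (K L N1 N2 k r : nat)
    (lo1 hi1 lo2 hi2 : nat -> nat) (A B : R) :
  bounded_monotone g c ->
  (forall i, (1 <= lo1 i)%N /\ (hi1 i - lo1 i <= N1)%N) ->
  (forall j, (1 <= lo2 j)%N /\ (hi2 j - lo2 j <= N2)%N) ->
  (K * N1 * (L * N2) = 2 ^ k)%N -> (N1 * N2 <= 2 ^ r)%N ->
  0 <= A -> 0 <= B ->
  (forall x y i j, (x < K)%N -> (y < L)%N ->
    (lo1 x <= i < hi1 x)%N -> (lo2 y <= j < hi2 y)%N ->
    ('E_P[fun w => (g (X i j w) `^ (2 * q))%R] <= A%:E)%E /\
    (('E_P[fun w => (g (X i j w) ^+ 2)%R]) `^ q <= B%:E)%E) ->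
  ('E_P[fun w => (\sum_(0 <= x < K) \sum_(0 <= y < L)
     `|centered_sum g (lo1 x) (hi1 x) (lo2 y) (hi2 y) w| `^ (2 * q))%R] <=
   (Num.max C0 0 * (2 ^+ k * (A + 2 `^ (r%:R * (q - 1)) * B)))%:E)%E.
Proof.
move=> gb h1 h2 KN NN A0 B0 AB; have [mg _ _] := gb.
have mG a1 a2 b1 b2 := measurable_norm_powR (2 * q) (measurable_centered_sum a1 a2 b1 b2 mg).
rewrite ge0_expectation_sum; last 2 first.
- by move=> x; apply: measurable_sum => y; exact: mG.
- by move=> x w; apply: sumr_ge0 => y _; exact: powR_ge0.
under eq_bigr do rewrite ge0_expectation_sum //.
set M := Num.max C0 0 * ((N1 * N2)%:R * A + (N1 * N2)%:R `^ q * B).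
have N12_gt0 : (0 < N1 * N2)%N.
  have : (0 < K * N1 * (L * N2))%N by rewrite KN expn_gt0.
  by rewrite !muln_gt0 => /andP[/andP[_ ->] /andP[_ ->]].
apply: (@le_trans _ _ (\sum_(0 <= x < K) \sum_(0 <= y < L) M%:E)%E).
  rewrite big_nat [leRHS]big_nat; apply: lee_sum => x xK.
  rewrite big_nat [leRHS]big_nat; apply: lee_sum => y yL.
  apply: centered_sum_moment => //.
  - exact: gb.
  - by case: (h1 x).
  - by case: (h2 y).
  - by rewrite leq_mul //; [case: (h1 x)|case: (h2 y)].
  - by move=> i j; exact: (AB x y i j xK yL).
under eq_bigr do rewrite sumEFin big_const_nat subn0 iter_addr_0.
rewrite sumEFin big_const_nat subn0 iter_addr_0 lee_fin -mulrnA.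
rewrite /M -mulrnAr ler_wpM2l ?le_max ?lexx ?orbT //.
set N := (N1 * N2)%N in N12_gt0 NN *.
have -> : N%:R `^ q = N%:R * N%:R `^ (q - 1) :> R.
  rewrite -{2}(powRr1 (ler0n _ N)) -powRD; first by rewrite addrC subrK.
  by rewrite pnatr_eq0 -lt0n N12_gt0 implybT.
rewrite -mulrA -mulrDr -mulr_natl mulrA -natrM.
have -> : (L * K * N = 2 ^ k)%N by rewrite -KN mulnACA (mulnC L).
rewrite natrX ler_wpM2l ?exprn_ge0 // lerD2l ler_wpM2r //.
rewrite powRrM powR_mulrn // -natrX.
by rewrite ge0_ler_powR ?nnegrE ?subr_ge0 // ler_nat.
Qed.

End Moments.

(** * Clipped variables and their increments *)

Section Clipping.
Context {R : realType} (b : nat -> R).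
Hypothesis b_gt0 : forall k, (1 <= k)%N -> 0 < b k.
Hypothesis b_le : forall k l, (1 <= k)%N -> (k <= l)%N -> b k <= b l.

Definition clip (k : nat) (x : R) : R := Num.min x (b (2 ^ k)%N).

Definition increment (k l : nat) (x : R) : R := clip l x - clip k x.

Lemma dyadic_bound_gt0 k : 0 < b (2 ^ k)%N.
Proof. by rewrite b_gt0 // expn_gt0. Qed.

Lemma dyadic_bound_le k l : (k <= l)%N -> b (2 ^ k)%N <= b (2 ^ l)%N.
Proof. by move=> kl; rewrite b_le ?expn_gt0 // leq_exp2l. Qed.

Lemma trunc_clip {d} {T : measurableType d} (X : nat -> nat -> T -> R) k i j w :
  trunc b X k i j w = clip k (X i j w).
Proof. by rewrite /trunc /clip; case: leP; rewrite ?mulr1 ?mulr0 ?addr0 ?add0r. Qed.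

Lemma clip_ge0 k x : 0 <= x -> 0 <= clip k x.
Proof. by move=> x0; rewrite /clip le_min x0 ltW ?dyadic_bound_gt0. Qed.

Lemma clip_le_level k l x : (k <= l)%N -> clip k x <= clip l x.
Proof.
by move=> /dyadic_bound_le kl; rewrite /clip le_min !ge_min lexx kl orbT.
Qed.

Lemma clip_bounded_monotone k : bounded_monotone (clip k) (b (2 ^ k)%N).
Proof.
split.
- by apply: measurable_minr => //; exact: measurable_id.
- by move=> x y xy; rewrite /clip le_min !ge_min xy lexx orbT.
- by move=> x x0; rewrite clip_ge0 //= /clip ge_min lexx orbT.
Qed.

Lemma increment_ge0 k l x : (k <= l)%N -> 0 <= increment k l x.
Proof. by move=> kl; rewrite subr_ge0 clip_le_level. Qed.

Lemma increment_le_clip k l x : 0 <= x -> increment k l x <= clip l x.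
Proof. by move=> x0; rewrite lerBlDr lerDl clip_ge0. Qed.

Lemma increment_le_indic k l x : 0 <= x ->
  increment k l x <= b (2 ^ l)%N * (b (2 ^ k)%N < x)%R%:R.
Proof.
move=> x0; have bk := dyadic_bound_gt0 k; have bl := dyadic_bound_gt0 l.
rewrite /increment /clip; case: (leP x (b (2 ^ k)%N)) => /= h; last first.
  by rewrite mulr1; case: (leP x (b (2 ^ l)%N)) => ?; lra.
by rewrite mulr0 subr_le0 ge_min lexx.
Qed.

(** [increment k l] is [x - b (2 ^ k)] clamped between [0] and
[b (2 ^ l) - b (2 ^ k)]; being nondecreasing, it is an admissible function in the
moment hypothesis. *)
Lemma increment_bounded_monotone k l : (k <= l)%N ->
  bounded_monotone (increment k l) (b (2 ^ l)%N).
Proof.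
move=> kl; have [ml _ bl] := clip_bounded_monotone l.
have [mk _ _] := clip_bounded_monotone k; have bkl := dyadic_bound_le kl.
split; first exact: measurable_funB.
- move=> x y xy; rewrite /increment /clip.
  case: (leP x (b (2 ^ k)%N)) => ?; case: (leP y (b (2 ^ k)%N)) => ?;
  case: (leP x (b (2 ^ l)%N)) => ?; case: (leP y (b (2 ^ l)%N)) => ?; lra.
- move=> x x0; rewrite increment_ge0 //= (le_trans (increment_le_clip k l x0)) //.
  by case/andP: (bl x x0).
Qed.

End Clipping.

Section TruncatedMoments.
Context {R : realType} {d : measure_display} {T : measurableType d}.
Context (P : probability T R) (q : R) (X : nat -> nat -> {RV P >-> R}) (b : nat -> R).
Hypothesis q1 : 1 <= q.
Hypothesis X0 : forall i j, (1 <= i)%N -> (1 <= j)%N -> forall w, 0 <= X i j w.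
Hypothesis b_gt0 : forall k, (1 <= k)%N -> 0 < b k.
Hypothesis b_le : forall k l, (1 <= k)%N -> (k <= l)%N -> b k <= b l.

Let clip_bm := clip_bounded_monotone b_gt0.
Let incr_bm := increment_bounded_monotone b_gt0 b_le.

Lemma expectation_comp_RV g c i j : bounded_monotone g c ->
  (1 <= i)%N -> (1 <= j)%N ->
  'E_P[fun w => g (X i j w)]%E \is a fin_num.
Proof.
move=> [mg _ gb] i1 j1.
have [//] := @expectation_bounded _ _ _ P (fun w => g (X i j w)) c
  (measurable_comp_RV X i j mg) (fun w => gb _ (X0 i1 j1 w)).
Qed.

Lemma expectation_increment k l i j : (k <= l)%N -> (1 <= i)%N -> (1 <= j)%N ->
  fine 'E_P[fun w => increment b k l (X i j w)] =
  fine 'E_P[fun w => clip b l (X i j w)] - fine 'E_P[fun w => clip b k (X i j w)].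
Proof.
move=> kl i1 j1.
have L e : (fun w => clip b e (X i j w)) \in Lfun P 1.
  have [mg _ gb] := clip_bm e.
  apply: (@Lfun1_bounded _ _ _ P _ (b (2 ^ e)%N)); first exact: measurable_comp_RV.
  by move=> w; case/andP: (gb _ (X0 i1 j1 w)) => h1 h2; rewrite ger0_norm.
rewrite -fineB ?(expectation_comp_RV (clip_bm _)) //.
by rewrite -expectationB.
Qed.

(** An increment vanishes unless [X] exceeds the lower level, and never exceeds
the upper one: this is where the tail probabilities enter. *)
Lemma expectation_increment_le k l i j (p : R) :
  (k <= l)%N -> (1 <= i)%N -> (1 <= j)%N ->
  (P [set w | (b (2 ^ k)%N < X i j w)%R] <= p%:E)%E ->
  fine 'E_P[fun w => increment b k l (X i j w)] <= b (2 ^ l)%N * p.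
Proof.
move=> kl i1 j1; set A := [set w | _] => Pp.
have bl := ltW (dyadic_bound_gt0 b_gt0 l).
have mA : measurable A by exact: measurable_gt_RV.
have [mg _ gb] := incr_bm kl.
have fin := expectation_comp_RV (incr_bm kl) i1 j1.
rewrite -lee_fin fineK //.
apply: (@le_trans _ _ 'E_P[fun w => (b (2 ^ l)%N * \1_A w)%R]%E).
  apply: expectation_le.
  - exact: measurable_comp_RV.
  - by exact: measurable_funM.
  - by move=> w; rewrite increment_ge0.
  - by move=> w; rewrite mulr_ge0.
  - apply: aeW => w; rewrite indicE.
    rewrite (le_trans (increment_le_indic b_gt0 k l (X0 i1 j1 w))) //.
    by rewrite ler_wpM2l // ler_nat; case: ltP => // h; rewrite mem_set.
rewrite ge0_expectationZ //.
by rewrite expectation_indic // EFinM lee_wpmul2l ?lee_fin.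
Qed.

(** Both the clipped variables and the increments lie below a clipped variable,
so their moments are those of the statement up to monotonicity. *)
Lemma moments_le_emax_trunc g c k m n i j :
  bounded_monotone g c -> (forall x, 0 <= x -> g x <= clip b k x) ->
  (1 <= i < 2 ^ m)%N -> (1 <= j < 2 ^ n)%N ->
  ('E_P[fun w => (g (X i j w) `^ (2 * q))%R] <= emax_dyadic m n (fun i j =>
     'E_P[fun w => (trunc b X k i j w `^ (2 * q))%R]))%E /\
  (('E_P[fun w => (g (X i j w) ^+ 2)%R]) `^ q <= emax_dyadic m n (fun i j =>
     ('E_P[fun w => (trunc b X k i j w ^+ 2)%R]) `^ q))%E.
Proof.
move=> [mg _ gb] gk hi hj.
have [i1 _] := andP hi; have [j1 _] := andP hj.
have q0 : 0 <= q by rewrite (le_trans _ q1).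
have [mc _ cb] := clip_bm k.
have mgX := measurable_comp_RV X i j mg; have mcX := measurable_comp_RV X i j mc.
have gX0 w : 0 <= g (X i j w) by case/andP: (gb _ (X0 i1 j1 w)).
have cX0 w : 0 <= clip b k (X i j w) by case/andP: (cb _ (X0 i1 j1 w)).
have gcX w : g (X i j w) <= clip b k (X i j w) by exact/gk/X0.
split.
  apply: le_trans (le_emax_dyadic _ hi hj).
  under [X in (_ <= 'E_P[X])%E]eq_fun do rewrite trunc_clip.
  apply: expectation_le.
  - exact: (measurableT_comp (measurable_powR _)).
  - exact: (measurableT_comp (measurable_powR _)).
  - by move=> w; exact: powR_ge0.
  - by move=> w; exact: powR_ge0.
  - by apply: aeW => w; rewrite ge0_ler_powR ?nnegrE ?mulr_ge0.
apply: le_trans (le_emax_dyadic _ hi hj).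
under [X in (_ <= 'E_P[X] `^ _)%E]eq_fun do rewrite trunc_clip.
have E0 (h : T -> R) : (0 <= 'E_P[fun w => (h w ^+ 2)%R])%E.
  by apply: expectation_ge0 => w; exact: sqr_ge0.
apply: gt0_ler_poweR; rewrite ?in_itv /= ?leey ?E0 //.
apply: expectation_le.
- exact: measurable_funX.
- exact: measurable_funX.
- by move=> w; exact: sqr_ge0.
- by move=> w; exact: sqr_ge0.
- by apply: aeW => w; rewrite ler_sqr ?nnegrE.
Qed.

Lemma emax_trunc_fineK m n k :
  let F := fun i j => 'E_P[fun w => (trunc b X k i j w `^ (2 * q))%R]%E in
  ((fine (emax_dyadic m n F))%:E = emax_dyadic m n F)%E /\ 0 <= fine (emax_dyadic m n F).
Proof.
move=> F; have q0 : 0 <= q by rewrite (le_trans _ q1).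
have [mc _ cb] := clip_bm k.
apply: (@emax_dyadic_fineK _ _ _ _ (b (2 ^ k)%N `^ (2 * q))); first exact: powR_ge0.
move=> i j i1 j1; rewrite /F.
under [X in ('E_P[X] <= _)%E]eq_fun do rewrite trunc_clip.
have [//|w|//] := @expectation_bounded _ _ _ P
  (fun w => clip b k (X i j w) `^ (2 * q)) (b (2 ^ k)%N `^ (2 * q)).
  exact: (measurableT_comp (measurable_powR _) (measurable_comp_RV X i j mc)).
case/andP: (cb _ (X0 i1 j1 w)) => c0 cle.
by rewrite powR_ge0 ge0_ler_powR ?nnegrE ?mulr_ge0 // (le_trans c0).
Qed.

Lemma emax_trunc2_fineK m n k :
  let F := fun i j => ('E_P[fun w => (trunc b X k i j w ^+ 2)%R] `^ q)%E in
  ((fine (emax_dyadic m n F))%:E = emax_dyadic m n F)%E /\ 0 <= fine (emax_dyadic m n F).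
Proof.
move=> F; have q0 : 0 <= q by rewrite (le_trans _ q1).
have [mc _ cb] := clip_bm k.
apply: (@emax_dyadic_fineK _ _ _ _ ((b (2 ^ k)%N ^+ 2) `^ q)); first exact: powR_ge0.
move=> i j i1 j1; rewrite /F.
under [X in ('E_P[X] `^ _ <= _)%E]eq_fun do rewrite trunc_clip.
rewrite -poweR_EFin; apply: gt0_ler_poweR => //.
- by rewrite in_itv /= leey expectation_ge0 // => w; exact: sqr_ge0.
- by rewrite in_itv /= leey lee_fin sqr_ge0.
have [//|w|//] := @expectation_bounded _ _ _ P
  (fun w => clip b k (X i j w) ^+ 2) (b (2 ^ k)%N ^+ 2).
  exact: measurable_funX (measurable_comp_RV X i j mc).
case/andP: (cb _ (X0 i1 j1 w)) => c0 cle.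
by rewrite sqr_ge0 ler_sqr ?nnegrE // (le_trans c0).
Qed.

End TruncatedMoments.

(** * The chaining inequality for the truncated array *)

Lemma ler_term_sum2_nat {R : realDomainType} (K L x0 y0 : nat) (F : nat -> nat -> R) :
  (x0 < K)%N -> (y0 < L)%N -> (forall x y, 0 <= F x y) ->
  F x0 y0 <= \sum_(0 <= x < K) \sum_(0 <= y < L) F x y.
Proof.
move=> xK yL F0; rewrite (big_rem x0) ?mem_index_iota //=.
rewrite ler_wpDr ?sumr_ge0 // => [x _|]; first exact: sumr_ge0.
by rewrite (big_rem y0) ?mem_index_iota //= lerDl sumr_ge0.
Qed.

Section Chaining.
Context {R : realType} {d : measure_display} {T : measurableType d}.
Context (P : probability T R) (q C0 : R) (X : nat -> nat -> {RV P >-> R}) (b : nat -> R).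
Context (lam : nat -> nat -> R) (m n : nat).
Hypothesis q1 : 1 <= q.
Hypothesis X0 : forall i j, (1 <= i)%N -> (1 <= j)%N -> forall w, 0 <= X i j w.
Hypothesis HX : condition_H q C0 [set p : nat * nat | (1 <= p.1)%N /\ (1 <= p.2)%N]
  (fun p => X p.1 p.2).
Hypothesis b_gt0 : forall k, (1 <= k)%N -> 0 < b k.
Hypothesis b_le : forall k l, (1 <= k)%N -> (k <= l)%N -> b k <= b l.
Hypothesis lam_gt0 : forall s t, (1 <= s <= m)%N -> (1 <= t <= n)%N -> 0 < lam s t.

Let clip_bm := clip_bounded_monotone b_gt0.
Let incr_bm := increment_bounded_monotone b_gt0 b_le.

(** For [x = u %/ 2 ^ s.-1] the interval [(x %/ 2 * 2 ^ s, x * 2 ^ s.-1]] is the cell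
of [u] at scale [s]; letting [x] and [y] run over all the possible indices gives
an upper bound for the maximum over [u] and [v]. *)
Definition cell_moment (l : nat * nat) (w : T) : R :=
  let: (s, t) := l in
  \sum_(0 <= x < 2 ^ (m - s.-1)) \sum_(0 <= y < 2 ^ (n - t.-1))
    `|centered_sum X (clip b (s + t - 2))
        (x %/ 2 * 2 ^ s).+1 (x * 2 ^ s.-1).+1
        (y %/ 2 * 2 ^ t).+1 (y * 2 ^ t.-1).+1 w| `^ (2 * q).

(** The same with the increments and the open dyadic blocks
[(x * 2 ^ s, x.+1 * 2 ^ s)], which for [x = u %/ 2 ^ s] contain the indices between
the rounding of [u] and [u].  Leaving out the right endpoint keeps all indices
below [2 ^ m]. *)
Definition block_moment (l : nat * nat) (w : T) : R :=
  let: (s, t) := l in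
  \sum_(0 <= x < 2 ^ (m - s)) \sum_(0 <= y < 2 ^ (n - t))
    `|centered_sum X (increment b (s + t - 2) (s + t))
        (x * 2 ^ s).+1 (x.+1 * 2 ^ s) (y * 2 ^ t).+1 (y.+1 * 2 ^ t) w| `^ (2 * q).

Definition scales : seq (nat * nat) :=
  [seq (s, t) | s <- index_iota 1 m.+1, t <- index_iota 1 n.+1].

Lemma mem_scales s t : ((s, t) \in scales) = (1 <= s <= m)%N && (1 <= t <= n)%N.
Proof.
apply/allpairsP/andP => [[[i j] /= []]|[hs ht]].
  by rewrite !mem_index_iota !ltnS => ? ? [-> ->].
by exists (s, t); rewrite /= !mem_index_iota !ltnS.
Qed.

Lemma divn_dyadic_lt e k u : (k <= e)%N -> (u < 2 ^ e)%N -> (u %/ 2 ^ k < 2 ^ (e - k))%N.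
Proof. by move=> ke ue; rewrite ltn_divLR ?expn_gt0 // -expnD subnK. Qed.

(** The sum of [W + E W] is the centered sum of [W] plus twice the sum of [E W]. *)
Lemma block_sum_le (k l a1 a2 b1 b2 N : nat) (p : R) w :
  (k <= l)%N -> (1 <= a1)%N -> (1 <= b1)%N -> (a2 <= 2 ^ m)%N -> (b2 <= 2 ^ n)%N ->
  ((a2 - a1) * (b2 - b1) <= N)%N -> 0 <= p ->
  (forall i j, (1 <= i < 2 ^ m)%N -> (1 <= j < 2 ^ n)%N ->
    (P [set w | (b (2 ^ k)%N < X i j w)%R] <= p%:E)%E) ->
  \sum_(a1 <= i < a2) \sum_(b1 <= j < b2)
    (clip b l (X i j w) + fine 'E_P[fun w => clip b l (X i j w)]
     - (clip b k (X i j w) + fine 'E_P[fun w => clip b k (X i j w)])) <=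
  `|centered_sum X (increment b k l) a1 a2 b1 b2 w|
  + 2 * (N%:R * b (2 ^ l)%N * p).
Proof.
move=> kl a1_gt0 b1_gt0 a2m b2n leN p0 Pp.
have bl := dyadic_bound_gt0 b_gt0 l.
pose c := 2 * (b (2 ^ l)%N * p).
have c0 : 0 <= c by rewrite !mulr_ge0 // ltW.
apply: (@le_trans _ _ (centered_sum X (increment b k l) a1 a2 b1 b2 w
   + \sum_(a1 <= i < a2) \sum_(b1 <= j < b2) c)).
  rewrite /centered_sum -big_split /=; apply: ler_sum_nat => i /andP[i1 i2].
  rewrite -big_split /=; apply: ler_sum_nat => j /andP[j1 j2].
  have {}i1 : (1 <= i)%N by exact: leq_trans i1.
  have {}j1 : (1 <= j)%N by exact: leq_trans j1.
  have hi : (1 <= i < 2 ^ m)%N by rewrite i1 (leq_trans i2).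
  have hj : (1 <= j < 2 ^ n)%N by rewrite j1 (leq_trans j2).
  have := expectation_increment_le X0 b_gt0 b_le kl i1 j1 (Pp i j hi hj).
  have := expectation_increment X0 b_gt0 kl i1 j1.
  rewrite /increment /c; lra.
apply: lerD; first exact: ler_norm.
rewrite big_const_nat iter_addr_0 big_const_nat iter_addr_0 -mulrnA mulnC.
rewrite -[leLHS]mulr_natl /c mulrCA ler_wpM2l // -mulrA ler_wpM2r ?ler_nat //.
by rewrite mulr_ge0 // ltW.
Qed.

(** The pointwise bound: the chaining inequality raised to the power [2 q].  The
right-hand side is the same for all [u] and [v]. *)
Lemma partial_sum_powR_le (Pi : nat -> R) u v w :
  (u < 2 ^ m)%N -> (v < 2 ^ n)%N ->
  (forall k, 0 <= Pi k) ->
  (forall k i j, (1 <= i < 2 ^ m)%N -> (1 <= j < 2 ^ n)%N ->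
    (P [set w | (b (2 ^ k)%N < X i j w)%R] <= (Pi k)%:E)%E) ->
  `|\sum_(1 <= i < u.+1) \sum_(1 <= j < v.+1)
     (trunc b X (m + n) i j w - fine 'E_P[trunc b X (m + n) i j])| `^ (2 * q) <=
  3 `^ (2 * q) * (2 * \sum_(l <- scales)
      2 ^+ (l.1 + l.2) * b (2 ^ (l.1 + l.2))%N * Pi (l.1 + l.2 - 2)%N) `^ (2 * q) +
  \sum_(l <- scales)
    3 `^ (2 * q) * (\sum_(l <- scales) lam l.1 l.2) `^ (2 * q) *
    lam l.1 l.2 `^ (- (2 * q)) * (cell_moment l w + block_moment l w).
Proof.
move=> um vn Pi0 PPi; set p := 2 * q; set a := \sum_(l <- scales) lam l.1 l.2.
have p0 : 0 < p by rewrite mulr_gt0 // (lt_le_trans _ q1).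
pose e k i j := fine 'E_P[fun w => clip b k (X i j w)].
pose z k i j := clip b k (X i j w) - e k i j.
pose y k i j := clip b k (X i j w) + e k i j.
have zy i j k l : (1 <= i)%N -> (1 <= j)%N -> (k <= l)%N ->
    `|z l i j - z k i j| <= y l i j - y k i j.
  move=> i1 j1 kl; have := increment_ge0 b_le (X i j w) kl.
  have : 0 <= fine 'E_P[fun w => increment b k l (X i j w)].
    apply: fine_ge0; apply: expectation_ge0 => w'.
    exact: (increment_ge0 b_le).
  rewrite (expectation_increment X0 b_gt0) // /increment /z /y /e ler_norml; lra.
have := dyadic_chaining um vn zy.
set S := \sum_(1 <= i < u.+1) _; set S' := \sum_(1 <= i < u.+1) _.
have -> : S = S'.
  rewrite /S /S'; apply: eq_bigr => i _; apply: eq_bigr => j _.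
  rewrite /z /e trunc_clip; congr (_ - fine _); congr ('E_P[_])%E.
  by apply/funext => w'; rewrite trunc_clip.
pose x1 (l : nat * nat) :=
  `|centered_sum X (clip b (l.1 + l.2 - 2))
     (dyadic_floor l.1 u).+1 (dyadic_floor l.1.-1 u).+1
     (dyadic_floor l.2 v).+1 (dyadic_floor l.2.-1 v).+1 w|.
pose x2 (l : nat * nat) :=
  `|centered_sum X (increment b (l.1 + l.2 - 2) (l.1 + l.2))
     (dyadic_floor l.1 u).+1 (dyadic_floor l.1 u + 2 ^ l.1)
     (dyadic_floor l.2 v).+1 (dyadic_floor l.2 v + 2 ^ l.2) w|.
pose pi (l : nat * nat) := 2 ^+ (l.1 + l.2) * b (2 ^ (l.1 + l.2))%N * Pi (l.1 + l.2 - 2)%N.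
have pi0 l : 0 <= pi l.
  by rewrite !mulr_ge0 // ?exprn_ge0 // ltW // dyadic_bound_gt0.
move=> chain.
have {chain} : `|S'| <= \sum_(l <- scales) x1 l + \sum_(l <- scales) x2 l
    + 2 * \sum_(l <- scales) pi l.
  apply: le_trans chain _; rewrite -addrA; apply: lerD.
    by rewrite /scales big_allpairs.
  rewrite mulr_sumr -big_split /scales big_allpairs /=.
  apply: ler_sum_nat => s /andP[s1 sm]; apply: ler_sum_nat => t /andP[t1 tn].
  rewrite ltnS in sm; rewrite ltnS in tn.
  rewrite /x2 /pi /= -natrX.
  apply: block_sum_le => //.
  - exact: leq_subr.
  - rewrite /dyadic_floor addnC -mulSn.
    have := divn_dyadic_lt sm um; rewrite -(leq_pmul2r (m := 2 ^ s)) ?expn_gt0 //.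
    by rewrite -expnD subnK.
  - rewrite /dyadic_floor addnC -mulSn.
    have := divn_dyadic_lt tn vn; rewrite -(leq_pmul2r (m := 2 ^ t)) ?expn_gt0 //.
    by rewrite -expnD subnK.
  - by rewrite expnD leq_mul // leq_subLR addSn ltnW // ltnS leq_add2r.
  - by move=> i j; exact: PPi.
move=> S'le.
have lam0 : {in scales, forall l, 0 < lam l.1 l.2}.
  by case=> s t; rewrite mem_scales => /andP[? ?]; exact: lam_gt0.
have x1p : {in scales, forall l, x1 l `^ p <= cell_moment l w}.
  case=> s t; rewrite mem_scales => /andP[/andP[s1 sm] /andP[t1 tn]].
  have floorE k c : (1 <= k)%N -> dyadic_floor k c = (c %/ 2 ^ k.-1 %/ 2 * 2 ^ k)%N.
    by case: k => // k _; rewrite /dyadic_floor /= -divnMA -expnSr.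
  rewrite /x1 /cell_moment /= (floorE s) // (floorE t) //.
  apply: (@ler_term_sum2_nat _ _ _ (u %/ 2 ^ s.-1) (v %/ 2 ^ t.-1)
    (fun x y => `|centered_sum X (clip b (s + t - 2))
        (x %/ 2 * 2 ^ s).+1 (x * 2 ^ s.-1).+1
        (y %/ 2 * 2 ^ t).+1 (y * 2 ^ t.-1).+1 w| `^ p)).
  - by apply: divn_dyadic_lt => //; rewrite (leq_trans (leq_pred _)).
  - by apply: divn_dyadic_lt => //; rewrite (leq_trans (leq_pred _)).
  - by move=> *; exact: powR_ge0.
have x2p : {in scales, forall l, x2 l `^ p <= block_moment l w}.
  case=> s t; rewrite mem_scales => /andP[/andP[s1 sm] /andP[t1 tn]].
  rewrite /x2 /block_moment /= /dyadic_floor ![(_ * _ + _)%N]addnC -!mulSn.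
  apply: (@ler_term_sum2_nat _ _ _ (u %/ 2 ^ s) (v %/ 2 ^ t)
    (fun x y => `|centered_sum X (increment b (s + t - 2) (s + t))
      (x * 2 ^ s).+1 (x.+1 * 2 ^ s) (y * 2 ^ t).+1 (y.+1 * 2 ^ t) w| `^ p)).
  - exact: divn_dyadic_lt.
  - exact: divn_dyadic_lt.
  - by move=> *; exact: powR_ge0.
have sum0 (x : nat * nat -> R) : (forall l, 0 <= x l) -> 0 <= \sum_(l <- scales) x l.
  by move=> x0; exact: sumr_ge0.
have weighted (x M : nat * nat -> R) : (forall l, 0 <= x l) ->
    {in scales, forall l, x l `^ p <= M l} ->
    (\sum_(l <- scales) x l) `^ p <=
    a `^ p * \sum_(l <- scales) lam l.1 l.2 `^ (- p) * M l.
  move=> x0 xM.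
  apply: le_trans (powR_sum_weighted p0 (fun l _ => x0 l) lam0) _.
  rewrite ler_wpM2l ?powR_ge0 // big_seq [leRHS]big_seq ler_sum // => l lr.
  by rewrite ler_wpM2l ?powR_ge0 ?xM.
have x10 l : 0 <= x1 l by exact: normr_ge0.
have x20 l : 0 <= x2 l by exact: normr_ge0.
apply: (@le_trans _ _ ((\sum_(l <- scales) x1 l + \sum_(l <- scales) x2 l
    + 2 * \sum_(l <- scales) pi l) `^ p)).
  rewrite ge0_ler_powR ?nnegrE ?(ltW p0) //.
  by rewrite !addr_ge0 ?mulr_ge0 ?sum0.
apply: le_trans (powR_add3_le p0 (sum0 _ x10) (sum0 _ x20) _) _.
  by rewrite mulr_ge0 ?sum0.
rewrite mulrDr addrC lerD2l.
have -> : \sum_(l <- scales) 3 `^ p * a `^ p * lam l.1 l.2 `^ (- p) *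
     (cell_moment l w + block_moment l w) =
   3 `^ p * (a `^ p * \sum_(l <- scales) lam l.1 l.2 `^ (- p) * cell_moment l w
    + a `^ p * \sum_(l <- scales) lam l.1 l.2 `^ (- p) * block_moment l w).
  rewrite -mulrDr -big_split /= mulrA mulr_sumr; apply: eq_bigr => l _.
  by rewrite -mulrDr mulrA.
by rewrite ler_wpM2l ?powR_ge0 // lerD ?weighted.
Qed.

(** A cell has at most [2 ^ s.-1 * 2 ^ t.-1] entries and there are twice as many
cells as blocks in each direction, so the product is again [2 ^ (m + n)]. *)
Lemma cell_moment_le s t (A B : R) : (1 <= s <= m)%N -> (1 <= t <= n)%N ->
  0 <= A -> 0 <= B ->
  (emax_dyadic m n (fun i j => 'E_P[fun w => (trunc b X (s + t) i j w `^ (2 * q))%R])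
     <= A%:E)%E ->
  (emax_dyadic m n (fun i j => ('E_P[fun w => (trunc b X (s + t) i j w ^+ 2)%R]) `^ q)
     <= B%:E)%E ->
  ('E_P[cell_moment (s, t)] <=
   (Num.max C0 0 * (2 ^+ (m + n) * (A + 2 `^ ((s + t)%:R * (q - 1)) * B)))%:E)%E.
Proof.
move=> /andP[s1 sm] /andP[t1 tn] A0 B0 AA BB.
have gk x : 0 <= x -> clip b (s + t - 2) x <= clip b (s + t) x.
  by move=> _; apply: (clip_le_level b_le); exact: leq_subr.
have size k x : (1 <= k)%N ->
    ((x * 2 ^ k.-1).+1 - (x %/ 2 * 2 ^ k).+1 <= 2 ^ k.-1)%N.
  case: k => // k _; rewrite subSS /= leq_subLR expnS mulnA -mulSnr leq_mul2r.
  apply/orP; right; rewrite {1}(divn_eq x 2) -[leqRHS]addn1 leq_add2l.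
  by rewrite -ltnS ltn_mod.
apply: (@sum_centered_sum_moment _ _ _ _ _ _ _ q1 X0 HX (clip b (s + t - 2))
  (b (2 ^ (s + t - 2))%N) _ _ (2 ^ s.-1) (2 ^ t.-1) _ _
  (fun x => (x %/ 2 * 2 ^ s).+1) (fun x => (x * 2 ^ s.-1).+1)
  (fun y => (y %/ 2 * 2 ^ t).+1) (fun y => (y * 2 ^ t.-1).+1)) => //.
- by move=> x; split=> //; exact: size.
- by move=> x; split=> //; exact: size.
- rewrite -!expnD !subnK //.
    by rewrite (leq_trans (leq_pred _)).
  by rewrite (leq_trans (leq_pred _)).
- by rewrite -expnD leq_exp2l // leq_add ?leq_pred.
move=> x y i j xK yL /andP[i1 i2] /andP[j1 j2].
have upper e k c : (1 <= k <= e)%N -> (c < 2 ^ (e - k.-1))%N -> (c * 2 ^ k.-1 < 2 ^ e)%N.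
  move=> /andP[k1 ke] cK; rewrite -[X in (_ < 2 ^ X)%N](subnK (leq_trans (leq_pred k) ke)).
  by rewrite expnD ltn_pmul2r ?expn_gt0.
have hi : (1 <= i < 2 ^ m)%N.
  rewrite (leq_trans _ i1) //= (leq_trans i2) // upper ?s1 //.
have hj : (1 <= j < 2 ^ n)%N.
  rewrite (leq_trans _ j1) //= (leq_trans j2) // upper ?t1 //.
have [h1 h2] := moments_le_emax_trunc q1 X0 b_gt0 (clip_bm _) gk hi hj.
by split; [exact: le_trans h1 AA | exact: le_trans h2 BB].
Qed.

Lemma block_moment_le s t (A B : R) : (1 <= s <= m)%N -> (1 <= t <= n)%N ->
  0 <= A -> 0 <= B ->
  (emax_dyadic m n (fun i j => 'E_P[fun w => (trunc b X (s + t) i j w `^ (2 * q))%R])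
     <= A%:E)%E ->
  (emax_dyadic m n (fun i j => ('E_P[fun w => (trunc b X (s + t) i j w ^+ 2)%R]) `^ q)
     <= B%:E)%E ->
  ('E_P[block_moment (s, t)] <=
   (Num.max C0 0 * (2 ^+ (m + n) * (A + 2 `^ ((s + t)%:R * (q - 1)) * B)))%:E)%E.
Proof.
move=> /andP[s1 sm] /andP[t1 tn] A0 B0 AA BB.
have kl : (s + t - 2 <= s + t)%N by exact: leq_subr.
have size k x : (x.+1 * 2 ^ k - (x * 2 ^ k).+1 <= 2 ^ k)%N.
  by rewrite leq_subLR mulSn addSn addnC ltnW.
apply: (@sum_centered_sum_moment _ _ _ _ _ _ _ q1 X0 HX (increment b (s + t - 2) (s + t))
  (b (2 ^ (s + t))%N) _ _ (2 ^ s) (2 ^ t) _ _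
  (fun x => (x * 2 ^ s).+1) (fun x => x.+1 * 2 ^ s)%N
  (fun y => (y * 2 ^ t).+1) (fun y => y.+1 * 2 ^ t)%N) => //.
- exact: incr_bm.
- by rewrite -!expnD !subnK.
- by rewrite -expnD.
move=> x y i j xK yL /andP[i1 i2] /andP[j1 j2].
have upper e k c : (k <= e)%N -> (c < 2 ^ (e - k))%N -> (c.+1 * 2 ^ k <= 2 ^ e)%N.
  move=> ke cK; rewrite -[X in (_ <= 2 ^ X)%N](subnK ke).
  by rewrite expnD leq_mul2r cK orbT.
have hi : (1 <= i < 2 ^ m)%N.
  by rewrite (leq_trans _ i1) //= (leq_trans i2) // upper.
have hj : (1 <= j < 2 ^ n)%N.
  by rewrite (leq_trans _ j1) //= (leq_trans j2) // upper.
have [h1 h2] := moments_le_emax_trunc q1 X0 b_gt0 (incr_bm kl)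
  (increment_le_clip b_gt0 _ _) hi hj.
by split; [exact: le_trans h1 AA | exact: le_trans h2 BB].
Qed.

End Chaining.

(** * The maximal inequality *)

Theorem theorem2p1 (R : realType) (q : R) (hq : 1 <= q) (C0 : R) :
  exists C : R,
  forall (d : measure_display) (T : measurableType d) (P : probability T R)
    (X : nat -> nat -> {RV P >-> R}) (b : nat -> R)
    (lam : nat -> nat -> nat -> nat -> R),
    (forall i j, (1 <= i)%N -> (1 <= j)%N -> forall w, 0 <= X i j w) ->
    condition_H q C0 [set p : nat * nat | (1 <= p.1)%N /\ (1 <= p.2)%N]
      (fun p => X p.1 p.2) ->
    (forall k, (1 <= k)%N -> 0 < b k) ->
    (forall k l, (1 <= k)%N -> (k <= l)%N -> b k <= b l) ->
    (forall m n i j, (1 <= i <= m)%N -> (1 <= j <= n)%N -> 0 < lam m n i j) ->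
    forall m n, (1 <= m)%N -> (1 <= n)%N ->
    ('E_P[fun w => (max_dyadic m n (fun u v =>
            `|\sum_(1 <= i < u.+1) \sum_(1 <= j < v.+1)
                (trunc b X (m + n) i j w
                 - fine 'E_P[trunc b X (m + n) i j])|) `^ (2 * q))%R]
     <= C%:E *
          (\sum_(1 <= s < m.+1) \sum_(1 <= t < n.+1)
             (2 ^+ (s + t) * b (2 ^ (s + t))%N)%:E *
             emax_dyadic m n (fun i j =>
               P [set w | (b (2 ^ (s + t - 2))%N < X i j w)%R])) `^ (2 * q)
        + C%:E * (lambda_sum lam m n `^ (2 * q))%:E *
          \sum_(1 <= s < m.+1) \sum_(1 <= t < n.+1)
             (2 ^+ (m + n) * lam m n s t `^ (- (2 * q)))%:E *
             (emax_dyadic m n (fun i j =>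
                'E_P[fun w => (trunc b X (s + t) i j w `^ (2 * q))%R])
              + (2 `^ ((s + t)%:R * (q - 1)))%:E *
                emax_dyadic m n (fun i j =>
                  ('E_P[fun w => (trunc b X (s + t) i j w ^+ 2)%R]) `^ q)))%E.
Proof.
have p0 : 0 < 2 * q by rewrite mulr_gt0 // (lt_le_trans _ hq).
pose C' := Num.max C0 0; have C'0 : 0 <= C' by rewrite le_max lexx orbT.
(* [6] is [3 * 2]: three sums raised to the power [2 q], one of them with a factor
   [2]; the summand [2 * C'] serves the cells and the blocks. *)
exists (6 `^ (2 * q) * (1 + 2 * C')).
move=> d T P X b lam X0 HX b_gt0 b_le lam_gt0 m n m1 n1.
set C := 6 `^ (2 * q) * _.
pose EP k := emax_dyadic m n (fun i j => P [set w | (b (2 ^ k)%N < X i j w)%R]).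
pose Pi k := fine (EP k).
(* from here on the maxima are replaced by real numbers *)
have [PiE Pi0] : (forall k, (Pi k)%:E = EP k) /\ (forall k, 0 <= Pi k).
  have P1 k i j : (1 <= i)%N -> (1 <= j)%N ->
      (P [set w | (b (2 ^ k)%N < X i j w)%R] <= 1%:E)%E.
    by move=> _ _; apply: probability_le1; exact: measurable_gt_RV.
  by split=> k; case: (emax_dyadic_fineK m n ler01 (P1 k)).
pose EA k := emax_dyadic m n
  (fun i j => 'E_P[fun w => (trunc b X k i j w `^ (2 * q))%R])%E.
pose EB k := emax_dyadic m n
  (fun i j => ('E_P[fun w => (trunc b X k i j w ^+ 2)%R] `^ q))%E.
pose A k := fine (EA k); pose B k := fine (EB k).
have AE k : (A k)%:E = EA k by case: (emax_trunc_fineK hq X0 b_gt0 m n k).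
have A0 k : 0 <= A k by case: (emax_trunc_fineK hq X0 b_gt0 m n k).
have BE k : (B k)%:E = EB k by case: (emax_trunc2_fineK hq X0 b_gt0 m n k).
have B0 k : 0 <= B k by case: (emax_trunc2_fineK hq X0 b_gt0 m n k).
have lamS s t : (1 <= s <= m)%N -> (1 <= t <= n)%N -> 0 < lam m n s t.
  by move=> *; exact: lam_gt0.
pose tails := \sum_(l <- scales m n)
  2 ^+ (l.1 + l.2) * b (2 ^ (l.1 + l.2))%N * Pi (l.1 + l.2 - 2)%N.
pose M s t := 2 ^+ (m + n) * (A (s + t)%N + 2 `^ ((s + t)%:R * (q - 1)) * B (s + t)%N).
pose a := \sum_(l <- scales m n) lam m n l.1 l.2.
pose moments := \sum_(l <- scales m n) lam m n l.1 l.2 `^ (- (2 * q)) * M l.1 l.2.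
have -> : (\sum_(1 <= s < m.+1) \sum_(1 <= t < n.+1)
    (2 ^+ (s + t) * b (2 ^ (s + t))%N)%:E * EP (s + t - 2)%N = tails%:E)%E.
  rewrite /tails -sumEFin big_allpairs.
  by apply: eq_bigr => s _; apply: eq_bigr => t _; rewrite -PiE.
have -> : (\sum_(1 <= s < m.+1) \sum_(1 <= t < n.+1)
    (2 ^+ (m + n) * lam m n s t `^ (- (2 * q)))%:E *
    (EA (s + t)%N + (2 `^ ((s + t)%:R * (q - 1)))%:E * EB (s + t)%N) = moments%:E)%E.
  rewrite /moments -sumEFin big_allpairs.
  apply: eq_bigr => s _; apply: eq_bigr => t _; rewrite -AE -BE.
  by rewrite /M /= mulrA (mulrC (lam m n s t `^ _)) [RHS]EFinM EFinD [X in (_ + X)%E]EFinM.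
have -> : lambda_sum lam m n = a by rewrite /a /scales big_allpairs.
rewrite poweR_EFin -!EFinM -EFinD.
have tails0 : 0 <= tails.
  apply: sumr_ge0 => l _.
  by rewrite !mulr_ge0 ?exprn_ge0 // ltW // b_gt0 // expn_gt0.
pose c0 := 3 `^ (2 * q) * (2 * tails) `^ (2 * q).
pose kap (l : nat * nat) := 3 `^ (2 * q) * a `^ (2 * q) * lam m n l.1 l.2 `^ (- (2 * q)).
have c00 : 0 <= c0 by rewrite mulr_ge0 ?powR_ge0.
have kap0 l : 0 <= kap l by rewrite !mulr_ge0 ?powR_ge0.
pose G l w := kap l * (cell_moment q X b m n l w + block_moment q X b m n l w).
have mcell l : measurable_fun setT (cell_moment q X b m n l).
  case: l => s t; do 2 (apply: measurable_sum => ?).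
  apply: measurable_norm_powR; apply: measurable_centered_sum.
  by case: (clip_bounded_monotone b_gt0 (s + t - 2)).
have mblock l : measurable_fun setT (block_moment q X b m n l).
  case: l => s t; do 2 (apply: measurable_sum => ?).
  apply: measurable_norm_powR; apply: measurable_centered_sum.
  by case: (increment_bounded_monotone b_gt0 b_le (leq_subr 2 (s + t))).
have cell0 l w : 0 <= cell_moment q X b m n l w.
  by case: l => s t; do 2 (apply: sumr_ge0 => ? _); exact: powR_ge0.
have block0 l w : 0 <= block_moment q X b m n l w.
  by case: l => s t; do 2 (apply: sumr_ge0 => ? _); exact: powR_ge0.
have G0 l w : 0 <= G l w by rewrite mulr_ge0 ?addr_ge0.
have mG l : measurable_fun setT (G l).
  by apply: measurable_funM => //; exact: measurable_funD.
apply: (@le_trans _ _ ('E_P[fun w => (c0 + \sum_(l <- scales m n) G l w)%R])%E).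
  apply: expectation_le.
  - apply: (measurableT_comp (measurable_powR _)).
    apply: measurable_max_dyadic => u v; apply: measurableT_comp => //.
    apply: measurable_sum => i; apply: measurable_sum => j.
    apply: measurable_funB => //.
    have -> : trunc b X (m + n) i j = (fun w => clip b (m + n) (X i j w)).
      by apply/funext => w; rewrite trunc_clip.
    apply: measurable_comp_RV.
    by case: (clip_bounded_monotone b_gt0 (m + n)).
  - by apply: measurable_funD => //; exact: measurable_sum.
  - by move=> w; exact: powR_ge0.
  - by move=> w; rewrite addr_ge0 ?sumr_ge0.
  - apply: aeW => w; apply: max_dyadic_powR_le => //.
      by rewrite addr_ge0 ?sumr_ge0.
    move=> u v /andP[_ um] /andP[_ vn]; split; first exact: normr_ge0.
    apply: (partial_sum_powR_le hq X0 b_gt0 b_le lamS w um vn Pi0).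
    by move=> k i j hi hj; rewrite PiE; exact: (le_emax_dyadic _ hi hj).
rewrite ge0_expectationD //; last 2 first.
- exact: measurable_sum.
- by move=> w; exact: sumr_ge0.
rewrite expectation_cst ge0_expectation_sum //.
apply: (@le_trans _ _ (c0%:E + \sum_(l <- scales m n)
    (kap l * (C' * M l.1 l.2 + C' * M l.1 l.2))%:E)%E).
  rewrite leeD2l // big_seq [leRHS]big_seq; apply: lee_sum => -[s t].
  rewrite mem_scales => /andP[hs ht].
  rewrite ge0_expectationZ //; last 2 first.
  - exact: measurable_funD.
  - by move=> w; rewrite addr_ge0.
  rewrite ge0_expectationD // [leRHS]EFinM lee_wpmul2l ?lee_fin // EFinD leeD //.
    by apply: (cell_moment_le hq X0 HX b_gt0 b_le) => //; rewrite ?AE ?BE.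
  by apply: (block_moment_le hq X0 HX b_gt0 b_le) => //; rewrite ?AE ?BE.
rewrite sumEFin -EFinD lee_fin.
have -> : \sum_(l <- scales m n) kap l * (C' * M l.1 l.2 + C' * M l.1 l.2) =
    3 `^ (2 * q) * (2 * C') * (a `^ (2 * q) * moments).
  rewrite /moments !mulr_sumr; apply: eq_bigr => l _; rewrite /kap; ring.
have -> : c0 = 6 `^ (2 * q) * tails `^ (2 * q).
  by rewrite /c0 powRM // mulrA -powRM // -natrM.
have M0 s t : 0 <= M s t.
  by rewrite mulr_ge0 ?exprn_ge0 ?addr_ge0 ?mulr_ge0 ?powR_ge0.
have mom0 : 0 <= moments by apply: sumr_ge0 => l _; rewrite mulr_ge0 ?powR_ge0.
rewrite -[X in _ <= _ + X]mulrA lerD // ler_wpM2r ?mulr_ge0 ?powR_ge0 //.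
  by rewrite /C ler_peMr ?powR_ge0 // lerDl mulr_ge0.
rewrite ler_pM ?powR_ge0 ?mulr_ge0 ?lerDr //.
by rewrite ge0_ler_powR ?nnegrE ?(ltW p0) // ler_nat.
Qed.
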